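(* Let $\Phi=(G,\varphi)$ be a $\mathbb{T}$-gain graph on a $2$-connected non-geodetic graph $G$. Then $\Phi$ is not distance compatible if and only if there exists an unbalanced even cycle $C$ in $\Phi$, of length $2l$ say, containing two diametrically opposite vertices $s,t$ (i.e. at distance $l$ along $C$) such that there is no path between $s$ and $t$ in $G$ of length smaller than $l$.
   Context: $\mathbb{T}=\{z\in\mathbb{C}:|z|=1\}$. A $\mathbb{T}$-gain graph $\Phi=(G,\varphi)$ on a simple graph $G$ with vertices $v_1,\dots,v_n$ assigns to each oriented edge $\overrightarrow{e}_{i,j}$ an element $\varphi(\overrightarrow{e}_{i,j})\in\mathbb{T}$ with $\varphi(\overrightarrow{e}_{j,i})=\varphi(\overrightarrow{e}_{i,j})^{-1}$. The gain of an oriented path or cycle is the product of the gains of its consecutive oriented edges; a cycle is unbalanced if its gain is not $1$. $G$ is geodetic if every two vertices are joined by a unique shortest path. $d(s,t)$ is the graph distance. $\mathcal{P}(s,t)$ is the set of oriented shortest paths from $s$ to $t$; $\mathcal{P}^{\max}(s,t)$ (resp. $\mathcal{P}^{\min}(s,t)$) is the set of those whose gain has maximum (resp. minimum) real part in $\mathcal{P}(s,t)$. For a total order $<$ and $s<t$, $\varphi^{<}_{\max}(s,t)$ is the gain of a path in $\mathcal{P}^{\max}(s,t)$ with maximum imaginary part of gain among paths in $\mathcal{P}^{\max}(s,t)$, and $\varphi^{<}_{\max}(t,s)=\overline{\varphi^{<}_{\max}(s,t)}$; $\varphi^{<}_{\min}(s,t)$ is the gain of a path in $\mathcal{P}^{\min}(s,t)$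 with minimum imaginary part of gain among paths in $\mathcal{P}^{\min}(s,t)$, and $\varphi^{<}_{\min}(t,s)=\overline{\varphi^{<}_{\min}(s,t)}$. $D^{\max}_{<}(\Phi)=(\varphi^{<}_{\max}(v_i,v_j)d(v_i,v_j))$, $D^{\min}_{<}(\Phi)=(\varphi^{<}_{\min}(v_i,v_j)d(v_i,v_j))$. $\Phi$ is distance compatible if $D^{\max}_{<}(\Phi)=D^{\min}_{<}(\Phi)$ for the standard order $v_1<\dots<v_n$. *)

(* Defs.v *)
From HB Require Import structures.
From mathcomp Require Import all_boot all_order all_algebra.
From mathcomp Require Import complex reals.

Set Implicit Arguments.
Unset Strict Implicit.
Unset Printing Implicit Defensive.

Import Order.TTheory GRing.Theory Num.Theory.
Local Open Scope ring_scope.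

(* The vertices v_1, ..., v_n are the elements of 'I_n. *)
Record sgraph (n : nat) := SGraph {
  adj :> rel 'I_n;
  adj_sym : symmetric adj;
  adj_irrefl : irreflexive adj }.

(* [gain_fun] is total; its values are only constrained, and only used, on the
   oriented edges of G. *)
Record gain_graph (R : realType) (n : nat) (G : sgraph n) := GainGraph {
  gain_fun :> 'I_n -> 'I_n -> R[i];
  gain_norm : forall i j, G i j -> `|gain_fun i j| = 1;
  gain_inv : forall i j, G i j -> gain_fun j i = (gain_fun i j)^-1 }.

Section Graph.
Variables (n : nat) (G : sgraph n).

(* The path s :: p; its length is size p. *)
Definition is_path (s t : 'I_n) (p : seq 'I_n) : bool :=
  [&& path G s p, last s p == t & uniq (s :: p)].

(* The cycle visits the vertices of c in order and then returns to the first. *)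
Definition is_cycle (c : seq 'I_n) : bool :=
  [&& (3 <= size c)%N, uniq c & cycle G c].

(* Least length of a path from s to t (a path has length < n); the value is n
   when there is no such path. *)
Definition dist (s t : 'I_n) : nat :=
  find (fun k => [exists p : k.-tuple 'I_n, is_path s t p]) (iota 0 n).

Definition geodesics (s t : 'I_n) : {set (dist s t).-tuple 'I_n} :=
  [set p : (dist s t).-tuple 'I_n | is_path s t p].

Definition geodetic : Prop :=
  forall s t : 'I_n, exists! p, p \in geodesics s t.

Definition connected_minus (X : {set 'I_n}) : Prop :=
  forall u v : 'I_n, u \notin X -> v \notin X ->
    connect [rel a b | [&& G a b, a \notin X & b \notin X]] u v.

Definition k_connected (k : nat) : Prop :=
  (k < n)%N /\ forall X : {set 'I_n}, (#|X| < k)%N -> connected_minus X.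

End Graph.

(* Distance between the vertices s and t of c when moving along the cycle c. *)
Definition cycle_dist (T : eqType) (c : seq T) (s t : T) : nat :=
  let k := (maxn (index s c) (index t c) - minn (index s c) (index t c))%N in
  minn k (size c - k).

Section Gain.
Variables (R : realType) (n : nat) (G : sgraph n) (Phi : gain_graph R G).

Definition path_gain (s : 'I_n) (p : seq 'I_n) : R[i] :=
  \prod_(z <- pairmap Phi s p) z.

Definition cycle_gain (c : seq 'I_n) : R[i] :=
  if c is x :: p then path_gain x (rcons p x) else 1.

Definition unbalanced (c : seq 'I_n) : Prop := cycle_gain c <> 1.

Definition geodesics_max (s t : 'I_n) : {set (dist G s t).-tuple 'I_n} :=
  [set p in geodesics G s t |
    [forall q in geodesics G s t,
       complex.Re (path_gain s q) <= complex.Re (path_gain s p)]].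

Definition geodesics_min (s t : 'I_n) : {set (dist G s t).-tuple 'I_n} :=
  [set p in geodesics G s t |
    [forall q in geodesics G s t,
       complex.Re (path_gain s p) <= complex.Re (path_gain s q)]].

(* All the paths that [pick] may return have the same gain, since the real and
   the imaginary part of the gain are both prescribed; the default 0 is reached
   only if t is not reachable from s. *)
Definition max_gain (s t : 'I_n) : R[i] :=
  oapp (fun p : (dist G s t).-tuple 'I_n => path_gain s p) 0
    [pick p in geodesics_max s t |
      [forall q in geodesics_max s t,
         complex.Im (path_gain s q) <= complex.Im (path_gain s p)]].

Definition min_gain (s t : 'I_n) : R[i] :=
  oapp (fun p : (dist G s t).-tuple 'I_n => path_gain s p) 0
    [pick p in geodesics_min s t |
      [forall q in geodesics_min s t,
         complex.Im (path_gain s p) <= complex.Im (path_gain s q)]].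

(* lt is a strict total order on the vertices. On the diagonal both functions
   give the gain 1 of the trivial path. *)
Definition phi_max (lt : rel 'I_n) (s t : 'I_n) : R[i] :=
  if lt s t then max_gain s t else conjc (max_gain t s).

Definition phi_min (lt : rel 'I_n) (s t : 'I_n) : R[i] :=
  if lt s t then min_gain s t else conjc (min_gain t s).

Definition Dmax (lt : rel 'I_n) : 'M[R[i]]_n :=
  \matrix_(i, j) (phi_max lt i j * (dist G i j)%:R).

Definition Dmin (lt : rel 'I_n) : 'M[R[i]]_n :=
  \matrix_(i, j) (phi_min lt i j * (dist G i j)%:R).

Definition std_lt : rel 'I_n := [rel i j : 'I_n | (i < j)%N].

Definition distance_compatible : Prop := Dmax std_lt = Dmin std_lt.

End Gain.

(* Main.v *)
Require Import Defs.
From mathcomp Require Import all_boot all_order all_algebra.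
From mathcomp Require Import complex reals.
From mathcomp Require Import zify boolp.

(** [Phi] is distance compatible iff, for all [s] and [t], all shortest paths
    from [s] to [t] have the same gain. The two halves of an unbalanced even
    cycle whose opposite vertices [s] and [t] are at distance [l] are shortest
    paths with different gains. Conversely, among all pairs of shortest paths
    with common ends and different gains take one of minimal length: a common
    inner vertex would split them into two shorter such pairs of shortest paths,
    one of which still has different gains. Hence the two paths are internally
    disjoint and form the required cycle. *)

Set Implicit Arguments.
Unset Strict Implicit.
Unset Printing Implicit Defensive.

Import Order.TTheory GRing.Theory Num.Theory.

(** * Shortest walks and graph distance *)

Section Distance.
Variables (n : nat) (G : sgraph n).
Implicit Types (s t x : 'I_n) (p q : seq 'I_n).

(** Minimality is tested against all walks, so replacing a prefix or a suffix of [p] gives an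
    admissible competitor even if vertices repeat. The endpoint stays implicit as [last s p], which
    avoids tuples whose type depends on [dist]. *)
Definition min_walk s p : Prop :=
  path G s p /\
  forall q, path G s q -> last s q = last s p -> (size p <= size q)%N.

Lemma walk_is_path s p : path G s p ->
  exists2 q, is_path G s (last s p) q & (size q <= size p)%N.
Proof.
move=> sp; case/shortenP: sp => q sq uq sub; exists q.
  by rewrite /is_path sq uq eqxx.
by apply: uniq_leq_size => //; case/andP: uq.
Qed.

Lemma rev_walk s p : path G s p -> path G (last s p) (rev (belast s p)).
Proof.
by move=> sp; rewrite rev_path (eq_path (e' := G)) // => a b; rewrite adj_sym.
Qed.

Lemma last_rev_belast s p : last (last s p) (rev (belast s p)) = s.
Proof. by case: p => //= a p; rewrite rev_cons last_rcons. Qed.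

Lemma is_path_rev s t p : is_path G s t p ->
  is_path G t s (rev (belast s p)).
Proof.
case/and3P=> sp /eqP <- up; rewrite /is_path rev_walk // last_rev_belast eqxx /=.
by move: up; rewrite lastI -rev_uniq rev_rcons.
Qed.

Lemma dist_attained s t p : is_path G s t p ->
  exists2 q, is_path G s t q & size q = dist G s t.
Proof.
move=> sp.
have szp : (size p < n)%N.
  case/and3P: sp => _ _ /card_uniqP /= <-.
  by apply: leq_trans (max_card _) _; rewrite card_ord.
set a := fun k => [exists q : k.-tuple 'I_n, is_path G s t q].
(* The vertices of a path are distinct, so its length is below [n] and the search defining [dist]
   succeeds. *)
have hasa : has a (iota 0 n).
  apply/hasP; exists (size p); first by rewrite mem_iota.
  by apply/existsP; exists (in_tuple p).
have := nth_find 0%N hasa; rewrite nth_iota; last first.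
  by have := hasa; rewrite has_find size_iota.
by case/existsP=> q Hq; exists q => //; rewrite size_tuple.
Qed.

Lemma dist_le s t p : is_path G s t p -> (dist G s t <= size p)%N.
Proof.
move=> sp; rewrite leqNgt; apply/negP => lt.
have szp : (size p < n)%N.
  case/and3P: sp => _ _ /card_uniqP /= <-.
  by apply: leq_trans (max_card _) _; rewrite card_ord.
have := before_find 0%N lt; rewrite nth_iota // => /existsP[].
by exists (in_tuple p).
Qed.

Lemma geodesic_min_walk s t (p : (dist G s t).-tuple 'I_n) :
  p \in geodesics G s t -> min_walk s p /\ last s p = t.
Proof.
rewrite inE => /and3P[sp /eqP lp up]; split=> //; split=> // q sq lq.
have [r sr] := walk_is_path sq; apply: leq_trans.
by rewrite size_tuple; apply: dist_le; rewrite lq lp in sr.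
Qed.

(** Removing the loops of [p] leaves a path [q] using only vertices of [p]. By minimality [q] is no
    shorter, so [p] and [q] have the same size and the same members, and [p] inherits uniqueness. *)
Lemma min_walk_uniq s p : min_walk s p -> uniq (s :: p).
Proof.
case=> sp; case/shortenP: (sp) => q sq uq sub min.
have szpq := min _ sq erefl.
have uq' : uniq q by case/andP: uq.
have [sz eqpq] := uniq_min_size uq' sub szpq.
by move: uq; rewrite /= eqpq (eq_uniq sz eqpq).
Qed.

Lemma min_walk_catl s p q : min_walk s (p ++ q) -> min_walk s p.
Proof.
case; rewrite cat_path => /andP[sp pq] min; split=> // r sr lr.
have := min (r ++ q); rewrite !cat_path !last_cat lr sr pq !size_cat leq_add2r.
exact.
Qed.

Lemma min_walk_catr s p q : min_walk s (p ++ q) -> min_walk (last s p) q.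
Proof.
case; rewrite cat_path => /andP[sp pq] min; split=> // r sr lr.
have := min (p ++ r); rewrite !cat_path !last_cat lr sp sr !size_cat leq_add2l.
exact.
Qed.

Lemma min_walk_rev s p : min_walk s p ->
  min_walk (last s p) (rev (belast s p)).
Proof.
case=> sp min; split=> [|q sq]; first exact: rev_walk.
rewrite last_rev_belast size_rev size_belast => lq.
have := rev_walk sq; have := last_rev_belast (last s p) q; rewrite lq => lr sr.
by have := min _ sr lr; rewrite size_rev size_belast.
Qed.

Lemma min_walk_size s p : min_walk s p -> size p = dist G s (last s p).
Proof.
move=> mp; have up := min_walk_uniq mp; case: mp => sp min.
have pp : is_path G s (last s p) p by rewrite /is_path sp eqxx.
apply/eqP; rewrite eqn_leq dist_le // andbT.
by have [q /and3P[sq /eqP lq _] <-] := dist_attained pp; apply: min.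
Qed.

(** Together with [geodesic_min_walk], this translates between the tuples of [geodesics] and plain
    sequences. *)
Lemma min_walk_geodesic s p : min_walk s p ->
  exists2 q : (dist G s (last s p)).-tuple 'I_n,
    q \in geodesics G s (last s p) & tval q = p.
Proof.
move=> mp; have/eqP szp := min_walk_size mp.
exists (Tuple szp) => //; rewrite inE /is_path /= eqxx.
by have /= -> := min_walk_uniq mp; case: mp => ->.
Qed.

End Distance.

(** * Gains of walks, extremal gains and distance compatibility *)

Section GainLemmas.
Local Open Scope ring_scope.
Variables (R : realType) (n : nat) (G : sgraph n) (Phi : gain_graph R G).
Implicit Types (s t x : 'I_n) (p q : seq 'I_n).

Lemma path_gain_cons s x p :
  path_gain Phi s (x :: p) = Phi s x * path_gain Phi x p.
Proof. by rewrite /path_gain /= big_cons. Qed.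

Lemma path_gain_cat s p q :
  path_gain Phi s (p ++ q) = path_gain Phi s p * path_gain Phi (last s p) q.
Proof.
elim: p s => [|x p IH] s /=; first by rewrite {2}/path_gain big_nil mul1r.
by rewrite !path_gain_cons IH mulrA.
Qed.

Lemma path_gain_neq0 s p : path G s p -> path_gain Phi s p != 0.
Proof.
elim: p s => [|x p IH] s /=; first by rewrite /path_gain big_nil oner_neq0.
case/andP=> sx xp; rewrite path_gain_cons mulf_neq0 ?IH //.
by rewrite -normr_eq0 gain_norm // oner_neq0.
Qed.

Lemma path_gain_rev s p : path G s p ->
  path_gain Phi (last s p) (rev (belast s p)) = (path_gain Phi s p)^-1.
Proof.
elim: p s => [|x p IH] s /=; first by rewrite /path_gain /= !big_nil invr1.
case/andP=> sx xp; rewrite rev_cons -cats1 path_gain_cat IH // last_rev_belast.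
rewrite !path_gain_cons (gain_inv Phi sx) /path_gain big_nil mulr1.
by rewrite invfM mulrC.
Qed.

(** Gains commute, so being unbalanced does not depend on the vertex at which the cycle starts. *)
Lemma cycle_gain_catC p q : cycle_gain Phi (p ++ q) = cycle_gain Phi (q ++ p).
Proof.
case: p q => [|a p] [|b q]; rewrite ?cats0 //=.
rewrite !rcons_cat !rcons_cons -!cat_rcons !path_gain_cat !last_rcons.
exact: mulrC.
Qed.

(** [max_gain] is the maximum for the lexicographic order on real and imaginary parts; the geodesic
    [p0] rules out the default value 0. *)
Lemma max_gainP s t (p0 : (dist G s t).-tuple 'I_n) :
  p0 \in geodesics G s t ->
  exists2 p : (dist G s t).-tuple 'I_n, p \in geodesics G s t &
    max_gain Phi s t = path_gain Phi s p /\
    forall q : (dist G s t).-tuple 'I_n, q \in geodesics G s t ->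
      complex.Re (path_gain Phi s q) <= complex.Re (path_gain Phi s p) /\
      (complex.Re (path_gain Phi s q) = complex.Re (path_gain Phi s p) ->
       complex.Im (path_gain Phi s q) <= complex.Im (path_gain Phi s p)).
Proof.
move=> g0; rewrite /max_gain; case: pickP => [p /andP[]|none] /=.
  rewrite inE => /andP[gp /forall_inP pRe] /forall_inP pIm.
  exists p => //; split=> // q gq; split; first exact: pRe.
  move=> eqRe; apply: pIm; rewrite inE gq /=; apply/forall_inP => r gr.
  by rewrite eqRe pRe.
(* The [pick] cannot fail: maximise the real part first, then the imaginary part among the
   maximisers. *)
case: (Order.TotalTheory.arg_maxP
  (fun p : (dist G s t).-tuple 'I_n => complex.Re (path_gain Phi s p)) g0).
move=> p1 gp1 max1.
have mp1 : p1 \in geodesics_max Phi s t.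
  by rewrite inE; apply/andP; split; [exact: gp1 | apply/forall_inP => q /max1].
case: (Order.TotalTheory.arg_maxP
  (fun p : (dist G s t).-tuple 'I_n => complex.Im (path_gain Phi s p)) mp1).
move=> p2 mp2 max2.
have /negP[] := negbT (none p2); apply/andP; split; first exact: mp2.
by apply/forall_inP => q /max2.
Qed.

Lemma min_gainP s t (p0 : (dist G s t).-tuple 'I_n) :
  p0 \in geodesics G s t ->
  exists2 p : (dist G s t).-tuple 'I_n, p \in geodesics G s t &
    min_gain Phi s t = path_gain Phi s p /\
    forall q : (dist G s t).-tuple 'I_n, q \in geodesics G s t ->
      complex.Re (path_gain Phi s p) <= complex.Re (path_gain Phi s q) /\
      (complex.Re (path_gain Phi s q) = complex.Re (path_gain Phi s p) ->
       complex.Im (path_gain Phi s p) <= complex.Im (path_gain Phi s q)).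
Proof.
move=> g0; rewrite /min_gain; case: pickP => [p /andP[]|none] /=.
  rewrite inE => /andP[gp /forall_inP pRe] /forall_inP pIm.
  exists p => //; split=> // q gq; split; first exact: pRe.
  move=> eqRe; apply: pIm; rewrite inE gq /=; apply/forall_inP => r gr.
  by rewrite eqRe pRe.
case: (Order.TotalTheory.arg_minP
  (fun p : (dist G s t).-tuple 'I_n => complex.Re (path_gain Phi s p)) g0).
move=> p1 gp1 min1.
have mp1 : p1 \in geodesics_min Phi s t.
  by rewrite inE; apply/andP; split; [exact: gp1 | apply/forall_inP => q /min1].
case: (Order.TotalTheory.arg_minP
  (fun p : (dist G s t).-tuple 'I_n => complex.Im (path_gain Phi s p)) mp1).
move=> p2 mp2 min2.
have /negP[] := negbT (none p2); apply/andP; split; first exact: mp2.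
by apply/forall_inP => q /min2.
Qed.

(** Every gain lies lexicographically between the two extremes, so it equals both once they
    coincide. *)
Lemma max_min_gain_eqP s t :
  max_gain Phi s t = min_gain Phi s t <->
  {in geodesics G s t &, forall p q : (dist G s t).-tuple 'I_n,
    path_gain Phi s p = path_gain Phi s q}.
Proof.
split=> [eqmm p q gp gq | eqg].
  have [p1 gp1 [e1 max1]] := max_gainP gp.
  have [p2 gp2 [e2 min2]] := min_gainP gp.
  have e12 : path_gain Phi s p1 = path_gain Phi s p2 by rewrite -e1 -e2.
  suff all1 (r : (dist G s t).-tuple 'I_n) : r \in geodesics G s t ->
      path_gain Phi s r = path_gain Phi s p1 by rewrite !all1.
  move=> gr; have [r1 i1] := max1 _ gr; have [r2 i2] := min2 _ gr.
  rewrite -e12 in r2 i2.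
  have eRe : complex.Re (path_gain Phi s r) = complex.Re (path_gain Phi s p1).
    by apply/eqP; rewrite eq_le r1 r2.
  by apply/eqP; rewrite eq_complex eRe eqxx eq_le i1 ?i2.
(* Without geodesics both picks fail, and both extremal gains are the default 0. *)
have [g0|[p gp]] := set_0Vmem (geodesics G s t).
  rewrite /max_gain /min_gain; case: pickP => [p /andP[]|_].
    by rewrite inE g0 inE.
  by case: pickP => [p /andP[]|//]; rewrite inE g0 inE.
have [p1 gp1 [-> _]] := max_gainP gp.
by have [p2 gp2 [-> _]] := min_gainP gp; apply: eqg.
Qed.

Lemma distance_compatibleP :
  distance_compatible Phi <->
  forall s p q, min_walk G s p -> min_walk G s q -> last s p = last s q ->
    path_gain Phi s p = path_gain Phi s q.
Proof.
split=> [eqD | eqg]; last first.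
  have eqmm s t : max_gain Phi s t = min_gain Phi s t.
    apply/max_min_gain_eqP => p q /geodesic_min_walk[mp lp].
    by case/geodesic_min_walk=> mq lq; apply: eqg => //; rewrite lp lq.
  by apply/matrixP => i j; rewrite !mxE /phi_max /phi_min !eqmm.
have lt_case s p q : (s < last s p)%N -> min_walk G s p -> min_walk G s q ->
    last s p = last s q -> path_gain Phi s p = path_gain Phi s q.
  move=> lt_s mp mq lpq; have szp := min_walk_size mp.
  have [p' gp <-] := min_walk_geodesic mp.
  have := min_walk_geodesic mq; rewrite -lpq => -[q' gq <-].
  apply: (iffLR (max_min_gain_eqP _ _)) => //.
  (* The distance factor can be cancelled: it is the length of [p], which is nonempty because its
     ends differ. *)
  have := congr1 (fun M : 'M_n => M s (last s p)) eqD.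
  rewrite !mxE /phi_max /phi_min /std_lt /= lt_s; apply: mulIf.
  by rewrite pnatr_eq0 -szp; case: (p) lt_s => //=; rewrite ltnn.
move=> s p q mp mq lpq.
have [lt_s|lt_s|eq_s] := ltngtP (s : nat) (last s p).
- exact: lt_case.
(* Reversing both walks inverts their gains and puts the ends in increasing order. *)
- apply: invr_inj; rewrite -!path_gain_rev; try by [case: mp | case: mq].
  rewrite -lpq; apply: lt_case; rewrite ?last_rev_belast //.
  + exact: min_walk_rev.
  + by rewrite lpq; apply: min_walk_rev.
  + by rewrite lpq last_rev_belast.
(* When the ends coincide, the empty walk competes, so both walks are empty. *)
have nil r : min_walk G s r -> last s r = last s p -> r = [::].
  case=> _ /(_ [::] isT) min lr; apply: size0nil; apply/eqP.
  by rewrite -leqn0 min //= lr; apply: ord_inj.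
by rewrite (nil p) // (nil q).
Qed.

End GainLemmas.

(** * Unbalanced even cycles and pairs of shortest paths *)

Section OppositeCycle.
Variables (R : realType) (n : nat) (G : sgraph n) (Phi : gain_graph R G).
Implicit Types (s t x : 'I_n) (p q c : seq 'I_n).

Definition has_opposite_unbalanced_cycle : Prop :=
  exists (c : seq 'I_n) (l : nat),
     [/\ is_cycle G c, size c = 2 * l, unbalanced Phi c &
         exists s t : 'I_n,
           [/\ s \in c, t \in c, cycle_dist c s t = l &
               ~ exists p : seq 'I_n, is_path G s t p /\ size p < l]].

Lemma min_walks_cycle s p q : min_walk G s p -> min_walk G s q ->
  last s p = last s q -> path_gain Phi s p <> path_gain Phi s q ->
  has_opposite_unbalanced_cycle.
Proof.
have [m] := ubnP (size p); elim: m s p q => // m IH s p q lt_m mp mq lpq gpq.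
have szpq : size p = size q.
  have [[sp minp] [sq minq]] := (mp, mq).
  by apply/eqP; rewrite eqn_leq minp //= minq.
case/lastP: p lt_m mp lpq gpq szpq => [|p t].
  by move=> _ _ _ gpq /esym/size0nil eq0; rewrite eq0 in gpq.
case/lastP: q mq => [|q t'] mq lt_m mp; first by rewrite size_rcons.
rewrite !last_rcons => eqt; rewrite -{t'}eqt in mq * => gpq.
rewrite !size_rcons => -[szpq].
case: (boolP (has (mem q) p)) => [/hasP[x xp /= xq]|disj].
  case/path.splitP: xp lt_m mp gpq szpq => p1 p2.
  case/path.splitP: xq mq => q1 q2; rewrite !rcons_cat => mq lt_m mp gpq szpq.
  (* Gains multiply along concatenation, so either the parts up to the common vertex [x] or the
     parts after it have different gains; both pairs are shorter. *)
  have [eq1|neq1] := eqVneq (path_gain Phi s (rcons p1 x))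
                            (path_gain Phi s (rcons q1 x)); last first.
    apply: (IH s (rcons p1 x) (rcons q1 x)); rewrite ?last_rcons //.
    + by move: lt_m; rewrite !size_cat !size_rcons; lia.
    + exact: min_walk_catl mp.
    + exact: min_walk_catl mq.
    + exact/eqP.
  apply: (IH x (rcons p2 t) (rcons q2 t)); rewrite ?last_rcons //.
  + by move: lt_m; rewrite !size_cat !size_rcons; lia.
  + by have := min_walk_catr mp; rewrite last_rcons.
  + by have := min_walk_catr mq; rewrite last_rcons.
  + by move=> eq2; apply: gpq; rewrite !path_gain_cat eq1 !last_rcons eq2.
have up := min_walk_uniq mp; have uq := min_walk_uniq mq.
have [sp minp] := mp; have [sq minq] := mq.
have revq : rev (belast s (rcons q t)) = rcons (rev q) s.
  by rewrite belast_rcons rev_cons.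
have sqr : path G t (rcons (rev q) s).
  by have := rev_walk sq; rewrite last_rcons revq.
have gqr : (path_gain Phi t (rcons (rev q) s) = (path_gain Phi s (rcons q t))^-1)%R.
  by have := path_gain_rev Phi sq; rewrite last_rcons revq.
(* If [p] were empty, both walks would be the single edge from [s] to [t] and have equal gains.
   Hence the cycle below has at least four vertices. *)
have p_gt0 : 0 < size p.
  rewrite lt0n; apply/eqP => p0; apply: gpq.
  by rewrite (size0nil p0) (@size0nil _ q) // -szpq.
have [tp sp' tq sq'] : [/\ t \notin p, s \notin p, t \notin q & s \notin q].
  move: up uq; rewrite /= !rcons_uniq !mem_rcons !inE !negb_or.
  by move=> /and3P[/andP[_ ->] -> _] /and3P[/andP[_ ->] -> _].
have st : s != t.
  by move: up; rewrite /= mem_rcons inE negb_or => /andP[/andP[]].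
(* Go from [s] to [t] through [p], then back through [q] reversed; each half has [size p] inner
   vertices, so [size p + 1] edges. *)
exists (s :: rcons p t ++ rev q), (size p).+1; split.
- rewrite /is_cycle /= size_cat size_rcons size_rev; apply/and3P; split; first lia.
    move: up uq; rewrite /= mem_cat mem_rev negb_or sq' andbT => /andP[-> up'].
    rewrite rcons_uniq => /and3P[_ _ uq].
    rewrite cat_uniq up' rev_uniq uq andbT /= has_rev has_sym has_rcons.
    by rewrite /= negb_or tq.
  by rewrite rcons_cat cat_path sp last_rcons.
- by rewrite /= size_cat size_rcons size_rev -szpq; lia.
- rewrite /unbalanced /= rcons_cat path_gain_cat last_rcons gqr => eq1.
  by apply: gpq; apply: divr1_eq.
exists s, t; split.
- by rewrite inE eqxx.
- by rewrite inE mem_cat mem_rcons inE eqxx orbT.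
- rewrite /cycle_dist /= eqxx (negbTE st) index_cat mem_rcons inE eqxx /=.
  rewrite -cats1 index_cat (negbTE tp) /= eqxx !size_cat size_rev /= -szpq.
  lia.
case=> r [/and3P[sr /eqP lr _]].
by rewrite ltnS leqNgt -(size_rcons p t) minp // last_rcons.
Qed.

Lemma opposite_cycle_min_walks c l s t :
  is_cycle G c -> size c = 2 * l -> unbalanced Phi c ->
  s \in c -> t \in c -> cycle_dist c s t = l ->
  (~ exists p, is_path G s t p /\ size p < l) -> index s c <= index t c ->
  exists p q, [/\ min_walk G s p, min_walk G s q, last s p = last s q &
    path_gain Phi s p <> path_gain Phi s q].
Proof.
case/and3P=> szc uc cc szl unb cs; case/splitPr: cs szc uc cc szl unb => A D.
move=> szc uc cc szl unb tc cd nosmall le_st.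
(* Rotate the cycle so that it starts at [s]. *)
have {}cc : cycle G (s :: D ++ A).
  by rewrite -(rot_cycle (size A)) rot_size_cat in cc.
have {}unb : unbalanced Phi (s :: D ++ A).
  by rewrite /unbalanced cycle_gain_catC in unb.
move: (uc); rewrite cat_uniq /= negb_or => /and3P[_ /andP[sA _] /andP[sD uD]].
have is_ : index s (A ++ s :: D) = size A.
  by rewrite index_cat (negbTE sA) /= eqxx addn0.
have tD : t \in D.
  move: tc; rewrite mem_cat inE => /or3P[tA|/eqP ets|//].
    by move: le_st; rewrite is_ index_cat tA leqNgt index_mem tA.
  (* If [t] were [s], then [l] would be 0, although the cycle has at least three vertices. *)
  by move: cd; rewrite ets /cycle_dist; lia.
case/splitPr: tD => B E in szc uc szl cd cc unb le_st sD uD is_ *.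
have tB : t \notin B by move: uD; rewrite cat_uniq /= negb_or => /and3P[_ /andP[]].
have ts : s != t by move: sD; rewrite mem_cat inE !negb_or => /and3P[].
have tA : t \notin A.
  move: uc; rewrite cat_uniq => /and3P[_ /hasPn dis _].
  by apply: dis; rewrite !(inE, mem_cat) eqxx !orbT.
have it : index t (A ++ s :: B ++ t :: E) = size A + (size B).+1.
  by rewrite index_cat (negbTE tA) /= (negbTE ts) index_cat (negbTE tB) /= eqxx addn0.
(* The two arcs have total length [2 * l] and the shorter has length [l], so both have length
   [l]. *)
have [szB szEA] : (size B).+1 = l /\ (size (E ++ A)).+1 = l.
  by move: cd szl; rewrite /cycle_dist is_ it !size_cat /= !size_cat /=; lia.
move: cc unb; rewrite /unbalanced /= -catA rcons_cat rcons_cons -cat_rcons.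
rewrite cat_path path_gain_cat last_rcons; set q := rcons _ s => /andP[sp tq] unb.
(* The bound on paths extends to walks, since a walk contains a path with the same ends that is no
   longer. *)
have minl r : path G s r -> last s r = t -> l <= size r.
  move=> sr lr; rewrite leqNgt; apply/negP => ltl; apply: nosmall.
  have [r' pr' szr'] := walk_is_path sr; exists r'; rewrite -lr; split=> //.
  exact: leq_ltn_trans ltl.
have lq : last t q = s by rewrite /q last_rcons.
(* These are the two arcs, the second reversed to run from [s] to [t]; equal gains would make the
   gain of the cycle 1. *)
exists (rcons B t), (rev (belast t q)).
have ltq : last s (rev (belast t q)) = t by rewrite -{1}lq last_rev_belast.
split.
- by split=> // r; rewrite size_rcons szB last_rcons; apply: minl.
- split=> [|r]; first by rewrite -{1}lq rev_walk.
  by rewrite ltq size_rev size_belast size_rcons szEA; apply: minl.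
- by rewrite last_rcons ltq.
have := path_gain_rev Phi tq; rewrite lq => -> eqg; apply: unb.
by rewrite eqg mulVf // path_gain_neq0.
Qed.

End OppositeCycle.

Theorem theorem6p4 (R : realType) (n : nat) (G : sgraph n)
    (Phi : gain_graph R G) :
  k_connected G 2 -> ~ geodetic G ->
  (~ distance_compatible Phi <->
   exists (c : seq 'I_n) (l : nat),
     [/\ is_cycle G c, size c = 2 * l, unbalanced Phi c &
         exists s t : 'I_n,
           [/\ s \in c, t \in c, cycle_dist c s t = l &
               ~ exists p : seq 'I_n, is_path G s t p /\ size p < l]]).
Proof.
move=> _ _; rewrite distance_compatibleP; split=> [ncompat | [c [l [cc szc unb]]]].
  apply: contrapT => nocyc; apply: ncompat => s p q mp mq lpq.
  by apply: contrapT => gpq; apply: nocyc; apply: min_walks_cycle gpq.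
case=> s [t [sc tc cd nosmall]] eqg.
(* The conditions on [s] and [t] are symmetric: [cycle_dist] is, and paths can be reversed. *)
wlog le_st : s t sc tc cd nosmall / index s c <= index t c.
  move=> th; case/orP: (leq_total (index s c) (index t c)); first exact: th.
  apply: th => //; first by rewrite -cd /cycle_dist maxnC (minnC (index t c)).
  case=> p [pp szp]; apply: nosmall; exists (rev (belast t p)).
  by rewrite size_rev size_belast; split=> //; apply: is_path_rev.
have [p [q [mp mq lpq]]] :=
  opposite_cycle_min_walks cc szc unb sc tc cd nosmall le_st.
by apply; apply: eqg.
Qed.
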